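(* There is a universal constant $c>0$ such that for every integer $d\ge1$, $$c_1(\mathcal{P}(\mathbb{F}_2^d),\mathcal{T}_\rho)\ge c\,d.$$ Moreover, for every $p\in[1,\infty)$ there is a constant $c(p)>0$ depending only on $p$ such that for every integer $d\ge 1$, $$c_p(\mathcal{P}(\mathbb{F}_2^d),\mathcal{T}_\rho)\ge c(p)\,d.$$
   Context: $\mathbb{F}_2^d=\{0,1\}^d$ with the Hamming metric $\rho(x,y)=|\{j: x_j\ne y_j\}|$. For a finite metric space $(X,d)$, $\mathcal{P}(X)$ is the set of all probability measures on $X$. For $\sigma,\tau\in\mathcal{P}(X)$, $\Pi(\sigma,\tau)$ is the set of probability measures $\pi$ on $X\times X$ with first marginal $\sigma$ and second marginal $\tau$, and the transportation cost metric is $\mathcal{T}_d(\sigma,\tau)=\inf_{\pi\in\Pi(\sigma,\tau)}\int_{X\times X}d(x,y)\,d\pi(x,y)$. Distortion: for metric spaces $(X,d_X),(Y,d_Y)$ and $f:X\to Y$, $\|f\|_{\mathrm{Lip}}=\sup_{x\ne y} d_Y(f(x),f(y))/d_X(x,y)$. If $f$ is one-to-one, $\mathrm{dist}(f)=\|f\|_{\mathrm{Lip}}\cdot\|f^{-1}\|_{\mathrm{Lip}}$ (with $f^{-1}$ defined on $f(X)$); otherwise $\mathrm{dist}(f)=\infty$. $c_Y(X)=\inf\{\mathrm{dist}(f): f:X\to Y\}$, and $c_p(X)=c_{L_p}(X)$, where $L_p=L_p([0,1])$. *)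

(* Defs.v *)
From HB Require Import structures.
From mathcomp Require Import all_boot all_order all_algebra.
From mathcomp Require Import all_classical all_reals all_analysis.
From mathcomp Require Import measurable_realfun lra.
Set Implicit Arguments.
Unset Strict Implicit.
Unset Printing Implicit Defensive.
Import Order.TTheory GRing.Theory Num.Theory.
Import numFieldNormedType.Exports.
Local Open Scope classical_set_scope.
Local Open Scope ring_scope.

Section distortion.
Context (R : realType) (X Y : metricType R).
Implicit Type f : X -> Y.

(* The maximum with 0 is the convention sup(empty set) = 0, which matters only
   for a one-point domain. *)
Definition lip_norm f : \bar R :=
  Order.max 0%E (ereal_sup
    [set (mdist (f z.1) (f z.2) / mdist z.1 z.2)%:E
       | z in [set z | z.1 != z.2]]).

(* For f one-to-one this is the Lipschitz norm of f^-1 : f(X) -> X, the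
   supremum over u != v in f(X) being written with u = f z.1 and v = f z.2. *)
Definition lip_norm_inv f : \bar R :=
  Order.max 0%E (ereal_sup
    [set (mdist z.1 z.2 / mdist (f z.1) (f z.2))%:E
       | z in [set z | f z.1 != f z.2]]).

Definition distortion f : \bar R :=
  if `[< injective f >] then (lip_norm f * lip_norm_inv f)%E else +oo%E.

Definition least_distortion : \bar R :=
  ereal_inf [set distortion f | f in [set: X -> Y]].

End distortion.

Section Lspace_metric.
Context d (T : measurableType d) (R : realType).
Variables (mu : {measure set T -> \bar R}) (p : \bar R) (p1 : (1 <= p)%E).
Implicit Types f g h : LspaceType mu p1.

HB.instance Definition _ := gen_eqMixin (LspaceType mu p1).
HB.instance Definition _ := gen_choiceMixin (LspaceType mu p1).

Definition Lspace_dist f g : R := fine 'N[mu]_p[EFin \o (f \- g)%R].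

Let mLspace f : measurable_fun setT (f : T -> R).
Proof. exact: (@measurable_funPT _ _ _ _ (repr (LebesgueSpace.sort f))). Qed.

Let Lspace_finite f : ('N[mu]_p[EFin \o f] < +oo)%E.
Proof. exact: Lebesgue_finite. Qed.

Let Lspace_distE f g : (Lspace_dist f g)%:E = 'N[mu]_p[EFin \o (f \- g)%R]%E.
Proof.
rewrite /Lspace_dist fineK// ge0_fin_numE ?Lnorm_ge0//.
have -> : (f \- g)%R = ((f : T -> R) \+ (\- g))%R by [].
have mg : measurable_fun setT (\- (g : T -> R))%R by exact: measurableT_comp.
apply: (le_lt_trans (eminkowski mu (mLspace f) mg p1)).
rewrite lte_add_pinfty//.
rewrite (_ : _ \o _ = \- (EFin \o g))%E// oppe_Lnorm.
exact: Lspace_finite.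
Qed.

Let Lspace_distxx f : Lspace_dist f f = 0.
Proof.
rewrite /Lspace_dist (_ : EFin \o _ = cst 0%E) ?Lnorm0 ?gt_eqF//.
  exact: lt_le_trans p1.
by apply/funext => x /=; rewrite subrr.
Qed.

Let Lspace_dist_eq0 f g : Lspace_dist f g = 0 -> f = g.
Proof.
move=> fg0; have : 'N[mu]_p[EFin \o (f \- g)%R]%E = 0%E.
  by rewrite -Lspace_distE fg0.
move=> /Lnorm_eq0_eq0 fg.
have {}fg : (f : T -> R) = g %[ae mu].
  have /measurable_EFinP/fg : measurable_fun setT ((f : T -> R) \- g).
    exact: measurable_funB.
  move=> /(_ (lt_le_trans lte01 p1)).
  apply: filterS => x /(_ I)/= [] /eqP.
  by rewrite subr_eq0 => /eqP.
case: f g {fg0} fg => [f [[ff]]] [g [[gf]]] /= /(ae_eqP f g)/eqP;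
rewrite !reprK => fg.
move: ff gf; rewrite fg => ff gf.
by rewrite (Prop_irrelevance ff gf).
Qed.

Let Lspace_dist_sym f g : Lspace_dist f g = Lspace_dist g f.
Proof.
rewrite /Lspace_dist -oppe_Lnorm; congr (fine ('N[mu]_p[_]))%E.
by apply/funext => x /=; rewrite opprB.
Qed.

Let Lspace_dist_triangle g f h :
  Lspace_dist f h <= Lspace_dist f g + Lspace_dist g h.
Proof.
rewrite -lee_fin EFinD !Lspace_distE.
rewrite (_ : f \- h = (f \- g) \+ (g \- h)); last first.
  by apply/funext => x /=; rewrite addrA subrK.
by apply: eminkowski => //; exact: measurable_funB.
Qed.

HB.instance Definition _ := isMetric.Build R (LspaceType mu p1)
  Lspace_distxx Lspace_dist_eq0 Lspace_dist_sym Lspace_dist_triangle.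

Lemma Lspace_mdistE f g :
  mdist f g = fine 'N[mu]_p[EFin \o (f \- g)%R].
Proof. by []. Qed.

End Lspace_metric.

(* Lebesgue measure on [0, 1], viewed as a measure on R carried by [0, 1]: the
   elements of its L^p space are classes of functions modulo equality almost
   everywhere on [0, 1]. *)
Definition lebesgue01 (R : realType) :
    {measure set (measurableTypeR R) -> \bar R} :=
  mrestr (@lebesgue_measure R) (@measurable_itv R `[0, 1]).

(* c_p(X), the distortion of X in L_p([0, 1]) *)
Definition Lp_distortion (R : realType) (p : \bar R) (p1 : (1 <= p)%E)
    (X : metricType R) : \bar R :=
  least_distortion X (LspaceType (lebesgue01 R) p1).

Definition hypercube (n : nat) : Type := 'rV['F_2]_n.

HB.instance Definition _ n := Finite.on (hypercube n).
HB.instance Definition _ n := isPointed.Build (hypercube n) (const_mx 0).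
HB.instance Definition _ n :=
  @isMeasurable.Build default_measure_display (hypercube n)
  discrete_measurable discrete_measurable0
  discrete_measurableC discrete_measurableU.

Definition hamming n (x y : hypercube n) : nat :=
  #|[set j | x 0 j != y 0 j]%SET|.

Section transportation.
Context d (T : measurableType d) (R : realType).

Definition couplings (s t : probability T R) :
    set (probability (T * T)%type R) :=
  [set pi | (forall A, measurable A -> pushforward pi fst A = s A) /\
            (forall A, measurable A -> pushforward pi snd A = t A)].

Definition transport_cost (rho : T -> T -> R) (s t : probability T R) :
    \bar R :=
  ereal_inf [set (\int[pi]_z (rho z.1 z.2)%:E)%E | pi in couplings s t].

End transportation.

Section finite_measures.
Context (R : realType) (I : finType) (i0 : I).

Section mfinite.
Context d (U : measurableType d).
Variables (q : I -> {nonneg R}) (a : I -> U).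

Definition mfinite : {measure set U -> \bar R} :=
  msum (fun k => mscale (q (nth i0 (enum I) k)) \d_(a (nth i0 (enum I) k)))
    #|I|.

Lemma integral_mfinite (f : U -> \bar R) : measurable_fun setT f ->
  (forall x, 0 <= f x)%E ->
  (\int[mfinite]_x f x = \sum_i (q i)%:num%:E * f (a i))%E.
Proof.
move=> mf f0; rewrite /mfinite ge0_integral_measure_sum//.
rewrite -(big_mkord xpredT (fun k => \int[mscale (q (nth i0 (enum I) k))
  \d_(a (nth i0 (enum I) k))]_x f x))%E cardE.
rewrite -(big_nth i0 xpredT (fun i => \int[mscale (q i) \d_(a i)]_x f x))%E.
rewrite big_enum/=; apply: eq_bigr => i _.
rewrite ge0_integral_mscale// integral_dirac//=.
by rewrite diracT mul1e.
Qed.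

Lemma mfiniteE (A : set U) : measurable A ->
  (mfinite A = \sum_i (q i)%:num%:E * (\1_A (a i))%:E)%E.
Proof.
move=> mA.
have <- : (\int[mfinite]_x (\1_A x)%:E = mfinite A)%E.
  by rewrite integral_indic// setIT.
rewrite (@integral_mfinite (EFin \o \1_A))//.
  exact/measurable_EFinP/measurable_indic.
by move=> x; rewrite lee_fin.
Qed.

End mfinite.

Section atoms.
Context d (U : measurableType d) (P : probability U R) (a : I -> U).
Hypothesis mU : forall A : set U, measurable A.
Hypothesis bij_a : bijective a.

Definition atom x : R := fine (P [set x]).

Lemma atom_ge0 x : 0 <= atom x.
Proof. exact: fine_ge0. Qed.

Lemma probability_atoms A : P A = (\sum_i atom (a i) * \1_A (a i))%:E.
Proof.
have [b ab ba] := bij_a.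
pose r := [seq i <- enum I | a i \in A].
rewrite [X in P X](_ : A = \bigcup_(i in [set` r]) [set a i]); last first.
  apply/seteqP; split => [x Ax|x [i /=]].
    by exists (b x) => /=; rewrite ?ba// mem_filter ba mem_enum andbT inE.
  by rewrite mem_filter => /andP[/set_mem Ai _ ->].
rewrite measure_fin_bigcup//=; last first.
  by move=> i j _ _ [x [/= -> /(can_inj ab)]].
have ur : uniq r by exact/filter_uniq/enum_uniq.
rewrite -(fsbig_seq _ _ ur) /r big_filter big_enum_cond/=.
rewrite big_mkcond/= -sumEFin; apply: eq_bigr => i _.
rewrite indicE; case: ifPn => _; last by rewrite mulr0.
by rewrite mulr1 /atom fineK// fin_num_measure.
Qed.

Lemma sum_atoms : \sum_i atom (a i) = 1.
Proof.
apply: EFin_inj; transitivity (P setT); last exact: probability_setT.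
rewrite probability_atoms.
by congr EFin; apply: eq_bigr => i _; rewrite indicT mulr1.
Qed.

Lemma integral_atoms (f : U -> R) : (forall x, 0 <= f x) ->
  (\int[P]_x (f x)%:E = (\sum_i atom (a i) * f (a i))%:E)%E.
Proof.
move=> f0; pose q i := NngNum (atom_ge0 (a i)).
rewrite (eq_measure_integral (mfinite q a)); last first.
  move=> A mA _; rewrite mfiniteE//; apply: (etrans (probability_atoms A)).
  rewrite -sumEFin.
  by apply: eq_bigr.
have mf : measurable_fun setT (EFin \o f) by move=> _ Y _; exact: mU.
have {}f0 x : (0 <= (EFin \o f) x)%E by rewrite lee_fin.
by rewrite (integral_mfinite _ _ mf f0) -sumEFin.
Qed.

End atoms.
End finite_measures.

Section probability_of_measure.
Context d (U : measurableType d) (R : realType) (m : {measure set U -> \bar R}).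
Hypothesis m1 : m setT = 1%E.

Definition mprob : set U -> \bar R := m.

HB.instance Definition _ := Measure.on mprob.
HB.instance Definition _ := Measure_isProbability.Build _ _ _ mprob m1.

Lemma exists_probability : exists P : probability U R, forall A, P A = m A.
Proof. by exists mprob. Qed.

End probability_of_measure.

Lemma eq_probability d (U : measurableType d) (R : realType)
    (s t : probability U R) :
  (forall A, measurable A -> s A = t A) ->
  (forall A : set U, measurable A) -> s = t.
Proof.
move=> st mU; have {mU} {}st : s = t :> (set U -> \bar R).
  by apply/funext => A; exact: st.
case: s t st => [s [[s1 s2] [s3] [s4] [s5] [s6] [s7] [s8]]].
case=> [t [[t1 t2] [t3] [t4] [t5] [t6] [t7] [t8]]] /= st; subst t.
rewrite (Prop_irrelevance s1 t1) (Prop_irrelevance s2 t2).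
rewrite (Prop_irrelevance s3 t3) (Prop_irrelevance s4 t4).
rewrite (Prop_irrelevance s5 t5) (Prop_irrelevance s6 t6).
by rewrite (Prop_irrelevance s7 t7) (Prop_irrelevance s8 t8).
Qed.

Section transport_metric.
Context (R : realType) (n : nat).
Local Notation T := (hypercube n).
Implicit Types (s t u : probability T R) (pi : probability (T * T)%type R).

Let mT (A : set T) : measurable A. Proof. by []. Qed.

Let mTT (A : set (T * T)) : measurable A.
Proof.
pose r := [seq z <- enum {: T * T} | z \in A].
rewrite (_ : A = \bigcup_(z in [set` r]) ([set z.1] `*` [set z.2])).
  by apply: fin_bigcup_measurable => // z _; exact: measurableX.
apply/seteqP; split => [[x y] Axy|[x y] [[x' y'] /=]].
  by exists (x, y) => //=; rewrite mem_filter mem_enum andbT inE.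
by rewrite mem_filter => /andP[/set_mem Ai _ [/= -> ->]].
Qed.

Let bij_id (I : Type) : bijective (@id I). Proof. by exists id. Qed.

Let atomsT s A : s A = (\sum_(x : T) atom s x * \1_A x)%:E.
Proof. exact: (probability_atoms s mT (bij_id T)). Qed.

Let atomsTT pi A : pi A = (\sum_(z : T * T) atom pi z * \1_A z)%:E.
Proof. exact: (probability_atoms pi mTT (bij_id _)). Qed.

Let ex pi (F : T * T -> R) := \sum_(z : T * T) atom pi z * F z.

Let exE pi F : (forall z, 0 <= F z) -> (\int[pi]_z (F z)%:E)%E = (ex pi F)%:E.
Proof.
exact: (integral_atoms (point : T * T) pi mTT (bij_id _)).
Qed.

Let fst_coupling s t pi f : couplings s t pi ->
  ex pi (f \o fst) = \sum_(x : T) atom s x * f x.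
Proof.
move=> [st _].
transitivity
    (\sum_(x : T) \sum_(z : T * T) atom pi z * (z.1 == x)%:R * f x).
  rewrite exchange_big; apply: eq_bigr => z _.
  rewrite (bigD1 z.1)//= eqxx mulr1 big1 ?addr0// => x.
  by rewrite eq_sym => /negbTE ->; rewrite mulr0 mul0r.
apply: eq_bigr => x _; rewrite -mulr_suml; congr (_ * _).
rewrite {2}/atom -(st _ (mT _)) /pushforward atomsTT/=.
apply: eq_bigr => z _; rewrite indicE; congr (_ * (nat_of_bool _)%:R).
by apply/eqP/idP; rewrite inE.
Qed.

Let snd_coupling s t pi f : couplings s t pi ->
  ex pi (f \o snd) = \sum_(x : T) atom t x * f x.
Proof.
move=> [_ st].
transitivity
    (\sum_(x : T) \sum_(z : T * T) atom pi z * (z.2 == x)%:R * f x).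
  rewrite exchange_big; apply: eq_bigr => z _.
  rewrite (bigD1 z.2)//= eqxx mulr1 big1 ?addr0// => x.
  by rewrite eq_sym => /negbTE ->; rewrite mulr0 mul0r.
apply: eq_bigr => x _; rewrite -mulr_suml; congr (_ * _).
rewrite {2}/atom -(st _ (mT _)) /pushforward atomsTT/=.
apply: eq_bigr => z _; rewrite indicE; congr (_ * (nat_of_bool _)%:R).
by apply/eqP/idP; rewrite inE.
Qed.

Let sum_atomT s : \sum_(x : T) atom s x = 1.
Proof. exact: (sum_atoms s mT (bij_id T)). Qed.

Let coupling_build (I : finType) (i0 : I) (q : I -> R) (a b : I -> T) s t :
  (forall i, 0 <= q i) ->
  (forall f, \sum_i q i * f (a i) = \sum_(x : T) atom s x * f x) ->
  (forall f, \sum_i q i * f (b i) = \sum_(x : T) atom t x * f x) ->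
  exists2 pi, couplings s t pi &
    forall F, (forall z, 0 <= F z) -> ex pi F = \sum_i q i * F (a i, b i).
Proof.
move=> q0 qa qb.
pose m := mfinite i0 (fun i => NngNum (q0 i)) (fun i => (a i, b i)).
have mE A : m A = (\sum_i q i * \1_A (a i, b i))%:E.
  by rewrite mfiniteE// -sumEFin; apply: eq_bigr.
have m1 : m setT = 1%E.
  rewrite mE; congr EFin; rewrite -(sum_atomT s).
  transitivity (\sum_(x : T) atom s x * 1); last by under eq_bigr do rewrite mulr1.
  by rewrite -(qa (cst 1)); apply: eq_bigr => i _; rewrite indicT.
have [pi piE] := exists_probability m1.
exists pi.
  split => A _; rewrite /pushforward/= piE mE atomsT; congr EFin.
    by rewrite -qa.
  by rewrite -qb.
move=> F F0; apply: EFin_inj; rewrite -exE//.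
rewrite (eq_measure_integral m); last by move=> A _ _; exact: piE.
have mF : measurable_fun setT (EFin \o F) by move=> _ Y _; exact: mTT.
have {}F0 x : (0 <= (EFin \o F) x)%E by rewrite lee_fin.
by rewrite (integral_mfinite _ _ _ mF F0) -sumEFin; apply: eq_bigr.
Qed.

Let sum_pair (F : T * T -> R) : \sum_z F z = \sum_x \sum_y F (x, y).
Proof. by rewrite pair_bigA; apply: eq_bigr => -[]. Qed.

Let marginal1 s t pi x : couplings s t pi ->
  \sum_(y : T) atom pi (x, y) = atom s x.
Proof.
move=> /fst_coupling st; have := st (fun a => (a == x)%:R).
rewrite /ex/= (bigD1 x)//= eqxx mulr1 [X in _ = _ + X]big1 ?addr0; last first.
  by move=> y /negbTE ->; rewrite mulr0.
move=> <-; rewrite sum_pair/=.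
rewrite [RHS](bigD1 x)//= [X in _ = _ + X]big1 ?addr0; last first.
  by move=> y /negbTE yx; rewrite big1// => z _; rewrite yx mulr0.
by apply: eq_bigr => y _; rewrite eqxx mulr1.
Qed.

Let marginal2 s t pi y : couplings s t pi ->
  \sum_(x : T) atom pi (x, y) = atom t y.
Proof.
move=> /snd_coupling st; have := st (fun a => (a == y)%:R).
rewrite /ex/= (bigD1 y)//= eqxx mulr1 [X in _ = _ + X]big1 ?addr0; last first.
  by move=> x /negbTE ->; rewrite mulr0.
move=> <-; rewrite sum_pair/=.
rewrite exchange_big [RHS](bigD1 y)//= [X in _ = _ + X]big1 ?addr0; last first.
  by move=> x /negbTE xy; rewrite big1// => z _; rewrite xy mulr0.
by apply: eq_bigr => x _; rewrite eqxx mulr1.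
Qed.

Let rho (x y : T) : R := (hamming x y)%:R.

Let rho_ge0 x y : 0 <= rho x y. Proof. exact: ler0n. Qed.

Let rhoxx x : rho x x = 0.
Proof.
rewrite /rho /hamming (_ : [set j | _]%SET = finset.set0) ?cards0//.
by apply/finset.setP => j; rewrite !inE eqxx.
Qed.

Let rho_ge1 x y : x != y -> 1 <= rho x y.
Proof.
move=> xy; rewrite ler1n card_gt0; apply: contra xy => /eqP/finset.setP xy.
by apply/eqP/rowP => j; have := xy j; rewrite !inE => /negbFE/eqP.
Qed.

Let rho_sym x y : rho x y = rho y x.
Proof.
rewrite /rho /hamming; congr (_%:R); apply: eq_card => j.
by rewrite !inE eq_sym.
Qed.

Let rho_triangle y x z : rho x z <= rho x y + rho y z.
Proof.
rewrite -natrD ler_nat (leq_trans _ (leq_card_setU _ _))//.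
apply/subset_leq_card/fintype.subsetP => j; rewrite !inE => xz.
by have [xy|//] := eqVneq (x 0 j) (y 0 j); rewrite -xy.
Qed.

Let cost pi := ex pi (fun z => rho z.1 z.2).

Let cost_ge0 pi : 0 <= cost pi.
Proof. by apply: sumr_ge0 => z _; rewrite mulr_ge0 ?atom_ge0. Qed.

Definition transport_dist s t : R :=
  fine (transport_cost (fun x y => (hamming x y)%:R) s t).

Let couplings_neq0 s t : exists pi, couplings s t pi.
Proof.
have [|f|f|pi] := @coupling_build _ (point : T * T)
  (fun z => atom s z.1 * atom t z.2) fst snd s t.
- by move=> i; rewrite mulr_ge0 ?atom_ge0.
- rewrite sum_pair/=.
  apply: eq_bigr => x _; rewrite -mulr_suml -mulr_sumr sum_atomT.
  by rewrite mulr1.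
- rewrite sum_pair/= exchange_big.
  by apply: eq_bigr => x _; rewrite -mulr_suml -mulr_suml sum_atomT mul1r.
by exists pi.
Qed.

Lemma transport_distE s t :
  transport_cost (fun x y => (hamming x y)%:R) s t = (transport_dist s t)%:E.
Proof.
rewrite /transport_dist fineK// fin_numElt; apply/andP; split.
  apply: (@lt_le_trans _ _ 0%E) => //; apply: le_ereal_inf_tmp => _ [pi _ <-].
  by apply: integral_ge0 => z _; rewrite lee_fin.
have [pi st] := couplings_neq0 s t.
apply: (@le_lt_trans _ _ (cost pi)%:E); last exact: ltry.
by apply: ereal_inf_lbound; exists pi => //; rewrite exE.
Qed.

Let transport_dist_le s t pi :
  couplings s t pi -> transport_dist s t <= cost pi.
Proof.
move=> st; rewrite -lee_fin -transport_distE.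
by apply: ereal_inf_lbound; exists pi => //; rewrite exE.
Qed.

Let le_transport_dist s t r : (forall pi, couplings s t pi -> r <= cost pi) ->
  r <= transport_dist s t.
Proof.
move=> st; rewrite -lee_fin -transport_distE.
by apply: le_ereal_inf_tmp => _ [pi /st + <-]; rewrite exE// lee_fin.
Qed.

Let transport_dist_ge0 s t : 0 <= transport_dist s t.
Proof. by apply: le_transport_dist => pi _; exact: cost_ge0. Qed.

Let transport_distxx s : transport_dist s s = 0.
Proof.
apply/eqP; rewrite eq_le transport_dist_ge0 andbT.
have [|f|f|pi ss piE] := @coupling_build T point (atom s) id id s s => //.
  by move=> x; rewrite atom_ge0.
rewrite (le_trans (transport_dist_le ss))// /cost piE//.
by rewrite big1// => x _; rewrite rhoxx mulr0.
Qed.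

Let transport_dist_sym s t : transport_dist s t = transport_dist t s.
Proof.
suff le s' t' : transport_dist s' t' <= transport_dist t' s'.
  by apply/eqP; rewrite eq_le !le.
apply: le_transport_dist => pi st.
have [|f|f|pi' ts piE] := @coupling_build _ (point : T * T) (atom pi) snd fst s' t'.
- by move=> z; rewrite atom_ge0.
- exact: snd_coupling st.
- exact: fst_coupling st.
rewrite (le_trans (transport_dist_le ts))// /cost piE//.
by apply: ler_sum => z _; rewrite /= rho_sym.
Qed.

Let transport_dist_eq0 s t : transport_dist s t = 0 -> s = t.
Proof.
move=> st0.
have le s' t' A : transport_dist s' t' = 0 -> (s' A <= t' A)%E.
  move=> st0'; rewrite !atomsT lee_fin -subr_le0 -[leRHS]st0'.
  apply: le_transport_dist => pi st.
  apply: (@le_trans _ _ (ex pi (\1_A \o fst) - ex pi (\1_A \o snd))).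
    by rewrite (fst_coupling _ st) (snd_coupling _ st).
  rewrite -sumrB.
  apply: ler_sum => z _; rewrite -mulrBr ler_wpM2l ?atom_ge0//=.
  have [->|/rho_ge1] := eqVneq z.1 z.2; first by rewrite subrr.
  by rewrite !indicE; case: (_ \in A); case: (_ \in A) => /=; lra.
apply: eq_probability => // A _; apply/eqP; rewrite eq_le !le//.
by rewrite transport_dist_sym.
Qed.

Let transport_dist_triangle t s u :
  transport_dist s u <= transport_dist s t + transport_dist t u.
Proof.
rewrite -lerBlDl; apply: le_transport_dist => p2 tu.
rewrite lerBlDl addrC -lerBlDl; apply: le_transport_dist => p1 st.
rewrite lerBlDl addrC.
pose q (i : T * T * T) := atom p1 i.1 * atom p2 (i.1.2, i.2) / atom t i.1.2.
have qE (F : T -> T -> T -> R) : \sum_i q i * F i.1.1 i.1.2 i.2 =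
    \sum_x \sum_y \sum_z q (x, y, z) * F x y z.
  rewrite pair_bigA/= (pair_bigA _ (fun i z => q (i.1, i.2, z) * F i.1 i.2 z))/=.
  by apply: eq_bigr => -[[]].
have q1 (g : T * T -> R) : \sum_i q i * g i.1 = ex p1 g.
  transitivity (\sum_i q i * g (i.1.1, i.1.2)).
    by apply: eq_bigr => -[[]].
  rewrite (qE (fun x y _ => g (x, y))) /ex.
  rewrite sum_pair.
  apply: eq_bigr => x _; apply: eq_bigr => y _.
  rewrite -mulr_suml; congr (_ * _); rewrite /q/= -mulr_suml -mulr_sumr.
  rewrite (marginal1 _ tu); have [ty0|ty0] := eqVneq (atom t y) 0; last first.
    by rewrite mulfK.
  rewrite ty0 mulr0 mul0r; apply/esym/eqP.
  have /eqP := marginal2 y st; rewrite ty0 psumr_eq0; last first.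
    by move=> z _; rewrite atom_ge0.
  by move=> /allP/(_ x (mem_index_enum _)).
have q2 (g : T * T -> R) : \sum_i q i * g (i.1.2, i.2) = ex p2 g.
  rewrite (qE (fun _ y z => g (y, z))) /ex sum_pair exchange_big/=.
  apply: eq_bigr => y _; rewrite exchange_big/=; apply: eq_bigr => z _.
  rewrite -mulr_suml; congr (_ * _); rewrite /q/= -mulr_suml -mulr_suml.
  rewrite (marginal2 _ st); have [ty0|ty0] := eqVneq (atom t y) 0; last first.
    by rewrite mulrC mulKf.
  rewrite ty0 !mul0r; apply/esym/eqP.
  have /eqP := marginal1 y tu; rewrite ty0 psumr_eq0; last first.
    by move=> x _; rewrite atom_ge0.
  by move=> /allP/(_ z (mem_index_enum _)).
have [|f|f|pi su piE] := @coupling_build _ (point : T * T * T) q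
  (fun i => i.1.1) (fun i => i.2) s u.
- by move=> i; rewrite /q mulr_ge0 ?invr_ge0 ?mulr_ge0 ?atom_ge0.
- by rewrite (q1 (f \o fst)); exact: fst_coupling st.
- by rewrite (q2 (f \o snd)); exact: snd_coupling tu.
rewrite (le_trans (transport_dist_le su))// /cost piE//=.
rewrite -(q1 (fun z => rho z.1 z.2)) -(q2 (fun z => rho z.1 z.2)) -big_split/=.
apply: ler_sum => i _; rewrite -mulrDr ler_wpM2l//.
by rewrite /q mulr_ge0 ?invr_ge0 ?mulr_ge0 ?atom_ge0.
Qed.

(* The metric space of probability measures on the cube, with the
   transportation cost associated with the Hamming metric; the cost is finite
   (transport_distE), so that fine loses nothing. *)
Definition cube_probability : Type := probability (hypercube n) R.

HB.instance Definition _ := gen_eqMixin cube_probability.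
HB.instance Definition _ := gen_choiceMixin cube_probability.
HB.instance Definition _ := @isMetric.Build R cube_probability
  transport_dist transport_distxx transport_dist_eq0 transport_dist_sym
  transport_dist_triangle.

Lemma cube_mdistE (s t : cube_probability) : mdist s t = transport_dist s t.
Proof. by []. Qed.

End transport_metric.

(* Main.v *)
(* Let G be a generator matrix of a binary linear code of length n, dimension k
   and minimum distance > n/16, so that 'rV_k, whose elements s stand for the
   cosets {x | x G^T = s} of the dual code, is a quotient of the cube.  Mapping
   a coset to its uniform measure embeds this quotient in the space of measures;
   adjacent cosets are at distance at most 1, and if k is large enough
   (Gilbert-Varshamov) then at least half of the pairs of cosets are at distance
   > n/16.  The eigenvalues of the Cayley graph of 'rV_k with respect to the
   columns of G are governed by the weights of the code words, so that this
   graph is an expander: it satisfies a Poincare inequality for squares, hence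
   for cuts, hence for absolute values, hence for p-th powers, hence, after
   integration over [0, 1], for L_p-valued maps.  A map with small distortion
   would contradict it. *)
Require Import Defs.
From HB Require Import structures.
From mathcomp Require Import all_boot all_order all_algebra.
From mathcomp Require Import all_classical all_reals all_analysis.
From mathcomp Require Import measurable_realfun ring lra.
Set Implicit Arguments.
Unset Strict Implicit.
Unset Printing Implicit Defensive.
Import Order.TTheory GRing.Theory Num.Theory.
Import numFieldNormedType.Exports.
Local Open Scope classical_set_scope.
Local Open Scope ring_scope.

(** * Hamming weight, ball sizes and codes of large minimum distance *)

Definition weight n (x : 'rV['F_2]_n) : nat := #|[set j | x 0 j != 0]%SET|.

Lemma F2_eq (a : 'F_2) : a = (a != 0)%:R.
Proof. by case: a => -[|[|//]] i; apply/val_inj. Qed.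

Lemma weight_eq0 n (x : 'rV['F_2]_n) : (weight x == 0)%N = (x == 0).
Proof.
rewrite /weight cards_eq0; apply/eqP/eqP => [/finset.setP x0|->].
  by apply/rowP => j; have := x0 j; rewrite !inE mxE => /negbFE/eqP.
by apply/finset.setP => j; rewrite !inE mxE eqxx.
Qed.

Lemma hammingE n (x y : hypercube n) :
  hamming x y = weight ((x : 'rV['F_2]_n) - y).
Proof.
by rewrite /hamming /weight; apply: eq_card => j; rewrite !inE !mxE subr_eq0.
Qed.

Definition ball_card n r := #|[set x : 'rV['F_2]_n | (weight x <= r)%N]%SET|.

(* Markov's inequality for 8 ^ (n - weight x), whose sum over x is 9 ^ n. *)
Lemma ball_card_le n r : (ball_card n r * 8 ^ n <= 8 ^ r * 9 ^ n)%N.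
Proof.
pose supp (x : 'rV['F_2]_n) := [set j | x 0 j != 0]%SET.
have supp_inj : injective supp.
  move=> x y /finset.setP xy; apply/rowP => j.
  by rewrite (F2_eq (x 0 j)) (F2_eq (y 0 j)); have := xy j; rewrite !inE => ->.
(* Vectors are indexed by their supports; [w A] is 8 ^ (n - #|A|), and its sum over all [A] expands
   the product of the n factors 1 + 8. *)
pose w (A : {set 'I_n}) := (\prod_(i < n) if i \in A then 1 else 8)%N.
have -> : (9 ^ n = \sum_(A : {set 'I_n}) w A)%N.
  by rewrite -bigA_distr prod_nat_const card_ord.
have wE x : (8 ^ n = w (supp x) * 8 ^ weight x)%N.
  rewrite -[in X in (_ ^ X)%N](card_ord n) -prod_nat_const.
  rewrite -[X in (_ * X)%N]prod_nat_const.
  rewrite [X in (_ * X)%N]big_mkcond -big_split /=.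
  by apply: eq_bigr => i _; rewrite inE; case: ifP.
rewrite /ball_card -sum_nat_const.
apply: (@leq_trans (\sum_(x : 'rV['F_2]_n) 8 ^ r * w (supp x))%N).
  rewrite big_mkcond/=; apply: leq_sum => x _; rewrite inE; case: ifP => // xr.
  by rewrite (wE x) mulnC leq_mul2r leq_exp2l// xr orbT.
rewrite -big_distrr leq_mul2l; apply/orP; right => /=.
rewrite -(big_imset w (in2W supp_inj))/=.
rewrite [X in (_ <= X)%N](bigID (mem (supp @: xpredT)))/=.
exact: leq_addr.
Qed.

Lemma ball_card0 n : ball_card n 0 = 1%N.
Proof.
transitivity #|[set (0 : 'rV['F_2]_n)]%SET|; last exact: cards1.
by apply: eq_card => x; rewrite !inE leqn0 weight_eq0.
Qed.

(** Squaring [ball_card_le] and using [16 * r <= n] with [1 <= r] reduces the claim to 128 * 81 ^ 16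
    <= 128 ^ 16. *)
Lemma ball_card_sqr n : (0 < n)%N ->
  (2 * ball_card n (n %/ 16) ^ 2 <= 2 ^ n)%N.
Proof.
move=> n0; have [n16|n16] := ltnP n 16.
  by rewrite divn_small// ball_card0 exp1n muln1; exact: (@leq_pexp2l 2 1).
set r := (n %/ 16)%N; set V := ball_card n r.
have r0 : (0 < r)%N by rewrite divn_gt0.
have nr : (16 * r <= n)%N by rewrite mulnC leq_trunc_div.
have VE : (V * 8 ^ n <= 8 ^ r * 9 ^ n)%N := ball_card_le n r.
have V2 : (V ^ 2 * 64 ^ n <= 64 ^ r * 81 ^ n)%N.
  rewrite -[64%N]/(8 ^ 2)%N -[81%N]/(9 ^ 2)%N -!expnM ![(2 * _)%N]mulnC !expnM.
  by rewrite -!expnMn leq_exp2r.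
rewrite -(leq_pmul2r (_ : 0 < 64 ^ n)%N) ?expn_gt0//.
rewrite -mulnA -expnMn -[(2 * 64)%N]/128%N.
apply: (leq_trans (leq_mul (leqnn 2) V2)).
rewrite mulnA -(subnKC nr) !(expnD _ (16 * r)%N) mulnA leq_mul//; last first.
  by case: (n - 16 * r)%N => // q; rewrite leq_exp2r.
apply: (@leq_trans (128 ^ r * 81 ^ (16 * r))%N).
  rewrite leq_mul2r; apply/orP; right.
  rewrite -[128%N]/(2 * 64)%N expnMn leq_mul2r -[X in (X <= _)%N](expn1 2).
  by rewrite leq_exp2l// r0 orbT.
rewrite [in X in (X <= _)%N]expnM [X in (_ <= X)%N]expnM -expnMn.
(* Seven of the eight squares in a sixteenth power each supply a factor 2, so only 2 * 81 ^ 2 <= 128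
   ^ 2 is evaluated. *)
have le16 (a b : nat) : (2 * a ^ 2 <= b ^ 2)%N -> (2 ^ 7 * a ^ 16 <= b ^ 16)%N.
  move=> ab; have powE c : (c ^ 16 = (c ^ 2) ^ 7 * c ^ 2)%N by rewrite -expnM -expnD.
  rewrite (powE a) (powE b) mulnA -expnMn leq_mul//; first by rewrite leq_exp2r.
  by apply: leq_trans ab; rewrite leq_pmull.
rewrite leq_exp2r; last exact: r0.
exact: (le16 81%N 128%N isT).
Qed.

Lemma card_rVF2 k : #|{: 'rV['F_2]_k}| = (2 ^ k)%N.
Proof. by rewrite card_mx mul1n card_Fp. Qed.

(* Gilbert-Varshamov: while the balls of radius r around the code words do not
   cover the space, an uncovered vector can be added to the basis. *)
Lemma exists_code n r k : (2 ^ k * ball_card n r < 2 ^ n.+1)%N ->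
  exists G : 'M['F_2]_(k, n), forall u, u != 0 -> (r < weight (u *m G))%N.
Proof.
elim: k => [|k IH] kn.
  by exists 0 => u; rewrite thinmx0 eqxx.
rewrite !expnS -mulnA ltn_pmul2l// in kn.
have [|G GP] := IH.
  by rewrite (leq_trans kn)// leq_exp2l.
pose B := [set u.1 *m G + u.2 |
  u in finset.setX [set: 'rV['F_2]_k] [set x : 'rV['F_2]_n | (weight x <= r)%N]]%SET.
have [v vB] : exists v, v \notin B.
  apply/existsP; rewrite -negb_forall; apply/negP => /forallP BT.
  have : (#|B| <= 2 ^ k * ball_card n r)%N.
    apply: (leq_trans (leq_imset_card _ _)).
    by rewrite finset.cardsX finset.cardsT card_rVF2.
  apply/negP; rewrite -ltnNge (leq_trans kn)// -card_rVF2.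
  by rewrite subset_leq_card//; apply/fintype.subsetP => v _; exact: BT.
exists (col_mx v G : 'M['F_2]_(1 + k, n)) => u.
have := @hsubmxK _ 1 1 k u; move: (lsubmx _) (rsubmx _) => a w <-.
rewrite (mul_row_col a w v G).
rewrite [a]mx11_scalar mul_scalar_mx.
have [->|a0] := eqVneq (a 0 0) 0.
  rewrite scale0r add0r => aw; apply: GP; apply: contraNneq aw => ->.
  by rewrite -scalemx1 scale0r row_mx0.
(* A word of weight at most [r] involving [v] would put [v] in the ball around the code word
   [- w *m G]. *)
move=> _; rewrite (F2_eq (a 0 0)) a0 scale1r ltnNge.
apply: contra vB => vr; apply/imsetP; exists (- w, v + w *m G).
  by rewrite !inE.
by rewrite /= mulNmx addrC addrK.
Qed.

(** Take the least [k] with 2V <= 2 ^ k. Minimality and [ball_card_sqr] give 2 ^ k V < 4 V ^ 2 <= 2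
    ^ (n + 1), as [exists_code] requires; 2V <= 2 ^ k will make at least half of the cosets far from
    any given one. *)
Lemma exists_large_code n (r := (n %/ 16)%N) : (0 < n)%N ->
  exists k (G : 'M['F_2]_(k, n)),
    (2 * ball_card n r <= 2 ^ k)%N /\
    forall u, u != 0 -> (r < weight (u *m G))%N.
Proof.
move=> n0; set V := ball_card n r.
have V0 : (0 < V)%N.
  by apply/card_gt0P; exists 0; rewrite inE (eqP (_ : weight 0 == 0)%N)// weight_eq0.
have /andP[klo khi] := @up_log_bounds 2 (2 * V) isT (leq_mul (leqnn 2) V0).
exists (up_log 2 (2 * V)).
have [|G GP] := @exists_code n r (up_log 2 (2 * V)); last by exists G.
have k0 : (0 < up_log 2 (2 * V))%N by rewrite up_log_gt0 // (leq_mul (leqnn 2) V0).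
rewrite -(prednK k0) !expnS -mulnA ltn_pmul2l//.
apply: leq_trans (ball_card_sqr n0).
by rewrite -/r -/V expnS expn1 mulnA ltn_pmul2r.
Qed.

(** * Walsh characters and the spectral gap of the Cayley graph *)

Section spectral_gap.
Variables (R : realFieldType) (k : nat).
Local Notation V := 'rV['F_2]_k.
Implicit Types (u x y g : V) (f : V -> R).

Definition F2_sign (a : 'F_2) : R := (-1) ^+ (a != 0).

Lemma F2_signD a b : F2_sign (a + b) = F2_sign a * F2_sign b.
Proof.
rewrite (F2_eq a) (F2_eq b) /F2_sign -signr_addb; congr (_ ^+ nat_of_bool _).
by case: (a != 0); case: (b != 0).
Qed.

Definition character u x : R := F2_sign ((u *m x^T) 0 0).

Lemma characterDr u x y : character u (x + y) = character u x * character u y.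
Proof. by rewrite /character linearD mulmxDr mxE F2_signD. Qed.

Lemma characterDl u v x : character (u + v) x = character u x * character v x.
Proof. by rewrite /character mulmxDl mxE F2_signD. Qed.

Lemma characterr0 u : character u 0 = 1.
Proof. by rewrite /character linear0 mulmx0 mxE /F2_sign eqxx expr0. Qed.

Lemma characterC u x : character u x = character x u.
Proof.
rewrite /character !mxE; congr F2_sign.
by apply: eq_bigr => j _; rewrite !mxE mulrC.
Qed.

(** Orthogonality: if coordinate [j] of [x] is nonzero, translating [u] by the [j]-th basis vector
    changes the sign of every term, so the sum equals its opposite. *)
Lemma sum_character x : \sum_u character u x = (2 ^ k)%:R *+ (x == 0).
Proof.
have [->|x0] := eqVneq x 0.
  rewrite (eq_bigr (fun=> 1)); last by move=> u _; exact: characterr0.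
  by rewrite sumr_const card_rVF2.
rewrite mulr0n; have [j xj] : exists j, x 0 j != 0.
  apply/existsP; apply: contraNT x0; rewrite negb_exists => /forallP x0.
  by apply/eqP/rowP => j; rewrite mxE; apply/eqP; rewrite -[_ == _]negbK x0.
have ej : character (delta_mx 0 j) x = -1.
  by rewrite characterC /character trmx_delta -colE mxE /F2_sign xj expr1.
apply/eqP; rewrite -[_ == 0](mulrn_eq0 _ 2) mulr2n -{2}[\sum_u _]mulr1 addr_eq0.
apply/eqP; rewrite mulr1 [LHS](reindex_inj (addIr (delta_mx 0 j)))/= -sumrN.
by apply: eq_bigr => u _; rewrite characterDl ej mulrN1.
Qed.

Definition fourier f u := \sum_x f x * character u x.

Lemma addrr_rVF2 x : x + x = 0.
Proof.
apply/rowP => j; rewrite !mxE.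
by case: (x 0 j) => -[|[|//]] i; apply/val_inj.
Qed.

(** After expanding the square, orthogonality keeps only the pairs with [y = x + g]; the case
    [g = 0] is Parseval's identity. *)
Lemma sum_fourier_sqr f g :
  \sum_u fourier f u ^+ 2 * character u g =
  (2 ^ k)%:R * \sum_x f x * f (x + g).
Proof.
transitivity (\sum_x \sum_y f x * f y * \sum_u character u (x + y + g)).
  under [RHS]eq_bigr do under eq_bigr do rewrite mulr_sumr.
  under [RHS]eq_bigr do rewrite exchange_big.
  rewrite [RHS]exchange_big/=; apply: eq_bigr => u _.
  rewrite expr2 mulr_suml mulr_suml; apply: eq_bigr => x _.
  rewrite mulr_sumr mulr_suml; apply: eq_bigr => y _.
  by rewrite !characterDr; ring.
rewrite mulr_sumr; apply: eq_bigr => x _.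
rewrite (bigD1 (x + g))//= sum_character addrA addrr_rVF2 add0r addrr_rVF2 eqxx.
rewrite mulr1n big1 ?addr0 => [|y yxg]; first by rewrite mulrC.
rewrite sum_character (_ : _ == 0 = false) ?mulr0n ?mulr0//.
apply: contraNF yxg => /eqP xyg; apply/eqP.
rewrite -[RHS]add0r -(addrr_rVF2 y) -addrA.
by rewrite [X in _ = _ + X]addrCA [X in _ = _ + X]addrA xyg addr0.
Qed.

(** Characters diagonalise the translation by [g], so the energy in direction [g] carries the factor
    [1 - character u g] at frequency [u]. *)
Lemma sum_sqr_shift f g :
  (2 ^ k)%:R * \sum_x (f x - f (x + g)) ^+ 2 =
  2 * \sum_u fourier f u ^+ 2 * (1 - character u g).
Proof.
have sf : \sum_x f (x + g) ^+ 2 = \sum_x f x ^+ 2.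
  by rewrite [RHS](reindex_inj (addIr g)).
have sf0 : \sum_u fourier f u ^+ 2 = (2 ^ k)%:R * \sum_x f x ^+ 2.
  transitivity (\sum_u fourier f u ^+ 2 * character u 0).
    by apply: eq_bigr => u _; rewrite characterr0 mulr1.
  rewrite sum_fourier_sqr; congr (_ * _).
  by apply: eq_bigr => x _; rewrite addr0 expr2.
have -> : \sum_u fourier f u ^+ 2 * (1 - character u g) =
    \sum_u fourier f u ^+ 2 - \sum_u fourier f u ^+ 2 * character u g.
  by rewrite -sumrB; apply: eq_bigr => u _; ring.
rewrite sum_fourier_sqr sf0.
have -> : \sum_x (f x - f (x + g)) ^+ 2 =
    \sum_x f x ^+ 2 + \sum_x f (x + g) ^+ 2 - 2 * \sum_x f x * f (x + g).
  rewrite mulr_sumr -sumrN -!big_split/=.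
  by apply: eq_bigr => x _; ring.
by rewrite sf; ring.
Qed.

(** Both sides are diagonal in Fourier space. Summed over all [g], [1 - character u g] gives 2 ^ k
    for each nonzero [u]; summed over the columns of [G] it gives twice the weight of the code word
    [u *m G]. The inequality thus holds frequency by frequency. *)
Lemma poincare_sqr n m (G : 'M['F_2]_(k, n)) f :
  (forall u, u != 0 -> (m <= weight (u *m G))%N) ->
  2 * m%:R * \sum_x \sum_y (f x - f y) ^+ 2 <=
  (2 ^ k)%:R * \sum_j \sum_x (f x - f (x + (col j G)^T)) ^+ 2.
Proof.
move=> mG.
have N0 : (2 ^ k)%:R != 0 :> R by rewrite pnatr_eq0 expn_eq0.
have allE : \sum_x \sum_y (f x - f y) ^+ 2 =
    2 * \sum_(u | u != 0) fourier f u ^+ 2.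
  apply: (mulfI N0).
  transitivity (\sum_g 2 * \sum_u fourier f u ^+ 2 * (1 - character u g)).
    under [RHS]eq_bigr do rewrite -sum_sqr_shift.
    rewrite -mulr_sumr [in RHS]exchange_big/=; congr (_ * _).
    apply: eq_bigr => x _; rewrite (reindex_inj (addrI x))/=.
    by [].
  rewrite -mulr_sumr mulrCA exchange_big/=; congr (_ * _).
  rewrite mulr_sumr [RHS]big_mkcond/=; apply: eq_bigr => u _.
  rewrite -mulr_sumr sumrB sumr_const card_rVF2.
  under eq_bigr do rewrite characterC.
  by rewrite sum_character; case: eqVneq => _ /=; ring.
have edgeE : (2 ^ k)%:R * \sum_j \sum_x (f x - f (x + (col j G)^T)) ^+ 2 =
    4 * \sum_u fourier f u ^+ 2 * (weight (u *m G))%:R.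
  rewrite [LHS]mulr_sumr.
  under eq_bigr do rewrite sum_sqr_shift.
  rewrite -mulr_sumr exchange_big/= (_ : 4 = 2 * 2)//; last by rewrite -natrM.
  rewrite -mulrA; congr (_ * _); rewrite mulr_sumr; apply: eq_bigr => u _.
  rewrite -mulr_sumr mulrCA; congr (_ * _).
  rewrite /weight -sum1_card natr_sum mulr_sumr [RHS]big_mkcond/=.
  apply: eq_bigr => j _; rewrite /character trmxK inE.
  have -> : (u *m col j G) 0 0 = (u *m G) 0 j.
    by rewrite !mxE; apply: eq_bigr => i _; rewrite mxE.
  by rewrite /F2_sign; case: eqP => _ /=; ring.
rewrite allE edgeE.
have -> : 2 * m%:R * (2 * \sum_(u | u != 0) fourier f u ^+ 2) =
    4 * (m%:R * \sum_(u | u != 0) fourier f u ^+ 2) by ring.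
rewrite ler_pM2l// mulr_sumr big_mkcond/=; apply: ler_sum => u _.
case: ifPn => u0; last by rewrite mulr_ge0 ?sqr_ge0.
by rewrite mulrC ler_wpM2l ?sqr_ge0// ler_nat mG.
Qed.

End spectral_gap.

(** * Reduction of distance inequalities on the line to cuts *)

(* Any l_1 (semi)metric on the line is a nonnegative combination of cuts. *)
Lemma le_sum_dist_cuts (R : realFieldType) (T I J : finType)
    (a b : I -> T) (c e : J -> T) (K L : R) :
  (forall A : {set T},
    K * \sum_i `|(a i \in A)%:R - (b i \in A)%:R| <=
    L * \sum_j `|(c j \in A)%:R - (e j \in A)%:R|) ->
  forall f : T -> R,
    K * \sum_i `|f (a i) - f (b i)| <= L * \sum_j `|f (c j) - f (e j)|.
Proof.
move=> cut f.
(* Adding a constant to [f] changes no difference. *)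
wlog f0 : f / forall x, 0 <= f x.
  move=> wl; pose C := \sum_x `|f x|.
  have fC u v : f u + C - (f v + C) = f u - f v by ring.
  have := wl (fun x => f x + C); under eq_bigr do rewrite fC.
  under [in leRHS]eq_bigr do rewrite fC.
  apply=> x; rewrite /C (bigD1 x)//= addrA addr_ge0 ?sumr_ge0//.
  by rewrite -lerBlDl sub0r -normrN ler_norm.
have [n] := ubnP #|[set x | f x != 0]%SET|.
elim: n => // n IH in f f0 *; rewrite ltnS => fn.
set A := [set x | f x != 0]%SET in fn.
have [A0|[x0 x0A]] := set_0Vmem A.
  have {}f0 x : f x = 0.
    by apply/eqP; move/finset.setP: A0 => /(_ x); rewrite !inE => /negbFE.
  rewrite !big1 ?mulr0// => i _; by rewrite !f0 subrr normr0.
have [y yA ymin] : exists2 y, y \in A & forall x, x \in A -> f y <= f x.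
  by case: (Order.TotalTheory.arg_minP f x0A) => y; exists y.
(* Removing the lowest positive level strictly shrinks the support, since [y] leaves it. Distances
   split additively because [f] is at least [f y] on [A] and 0 outside. *)
pose g x := f x - f y * (x \in A)%:R.
have fE x z : `|f x - f z| = `|g x - g z| + f y * `|(x \in A)%:R - (z \in A)%:R|.
  have nA w : w \notin A -> f w = 0 by rewrite inE negbK => /eqP.
  have yge0 := f0 y.
  rewrite /g; case: (boolP (x \in A)) => xA; case: (boolP (z \in A)) => zA /=.
  - by rewrite !mulr1 subrr normr0 mulr0 addr0 opprB addrA subrK.
  - rewrite (nA _ zA) mulr1 mulr0 !subr0 normr1 mulr1 !ger0_norm ?subr_ge0 ?ymin//.
    by rewrite subrK.
  - rewrite (nA _ xA) mulr1 mulr0 !subr0 !sub0r !normrN normr1 mulr1.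
    by rewrite !ger0_norm ?subr_ge0 ?ymin// subrK.
  - by rewrite mulr0 !subr0 normr0 mulr0 addr0.
under eq_bigr do rewrite fE.
under [in leRHS]eq_bigr do rewrite fE.
rewrite !big_split/= !mulrDr lerD//; last first.
  by rewrite -!mulr_sumr ![_ * (f y * _)]mulrCA ler_wpM2l.
apply: IH.
  move=> x; rewrite /g; case: (boolP (x \in A)) => xA /=.
    by rewrite mulr1 subr_ge0 ymin.
  by rewrite mulr0 subr0.
apply: (leq_trans _ fn); apply: proper_card; apply/properP; split.
  apply/fintype.subsetP => x; rewrite !inE; apply: contraNneq => fx.
  by rewrite /g inE fx eqxx mulr0 subr0.
by exists y => //; rewrite inE /g yA mulr1 subrr eqxx.
Qed.

(** * Estimates for p-th powers and their odd extension *)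

Section signed_power.
Variable R : realType.
Implicit Types (a b t x eps p : R) (q : nat).

(** Replacing [p] by the integer [q] only lowers the power of [t]; what remains is Bernoulli's
    inequality, by induction on [q]. *)
Lemma onem_powR_le t p q : 0 <= t <= 1 -> 0 < p -> p <= q%:R ->
  1 - t `^ p <= q%:R * (1 - t).
Proof.
move=> /andP[t0 t1] p0 pq.
have q0 : (0 < q)%N by rewrite -(ltr_nat R) (lt_le_trans p0).
have [->|tn0] := eqVneq t 0.
  by rewrite powR0 ?gt_eqF// !subr0 mulr1 ler1n.
have tgt0 : 0 < t by rewrite lt_neqAle eq_sym tn0.
apply: (@le_trans _ _ (1 - t ^+ q)).
  by rewrite lerD2l lerN2 -powR_mulrn// ger_powR// tgt0.
elim: q {q0 pq} => [|q IH]; first by rewrite expr0 subrr mul0r.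
rewrite exprS -natr1 mulrDl mul1r.
have -> : 1 - t * t ^+ q = t * (1 - t ^+ q) + (1 - t) by ring.
rewrite lerD2r; apply: le_trans IH.
by rewrite ler_piMl// subr_ge0 exprn_ile1.
Qed.

Lemma powRB_le a b p q : 0 <= b <= a -> 0 < p -> p <= q%:R ->
  a `^ p - b `^ p <= q%:R * ((a - b) * a `^ (p - 1)).
Proof.
move=> /andP[b0 ba] p0 pq; have a0 := le_trans b0 ba.
have [a0'|an0] := eqVneq a 0.
  have -> : b = a by apply/eqP; rewrite eq_le ba a0' b0.
  by rewrite !subrr mul0r mulr0.
have agt0 : 0 < a by rewrite lt_neqAle eq_sym an0.
pose t := b / a.
have t01 : 0 <= t <= 1 by rewrite divr_ge0// ler_pdivrMr// mul1r.
have bE : b = a * t by rewrite /t mulrC divfK.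
rewrite bE powRM//; last by case/andP: t01.
have -> : a `^ p - a `^ p * t `^ p = a `^ p * (1 - t `^ p) by ring.
rewrite -(mulr_powRB1 a0 p0).
have -> : q%:R * ((a - a * t) * a `^ (p - 1)) =
  a * a `^ (p - 1) * (q%:R * (1 - t)) by ring.
by rewrite ler_wpM2l ?onem_powR_le// mulr_ge0// powR_ge0.
Qed.

(** A crude Young inequality: if [x <= eps * a] the first term suffices, otherwise [a < x / eps] and
    the second does. A small [eps] allows the first term to be absorbed later. *)
Lemma mul_powRB1_le x a eps p : 0 <= x -> 0 <= a -> 0 < eps -> 1 <= p ->
  x * a `^ (p - 1) <= eps * a `^ p + eps `^ (1 - p) * x `^ p.
Proof.
move=> x0 a0 e0 p1; have p0 : 0 < p by exact: lt_le_trans p1.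
have [xa|ax] := leP x (eps * a).
  rewrite -[leLHS]addr0 lerD ?mulr_ge0 ?powR_ge0//.
  by rewrite -(mulr_powRB1 a0 p0) mulrA ler_wpM2r ?powR_ge0.
rewrite -[leLHS]add0r lerD ?mulr_ge0 ?powR_ge0 ?(ltW e0)//.
rewrite -(mulr_powRB1 x0 p0) mulrCA ler_wpM2l//.
rewrite -(opprB p 1) powRN ler_pdivlMl ?powR_gt0// -powRM ?(ltW e0)//.
rewrite ge0_ler_powR ?subr_ge0 ?nnegrE ?mulr_ge0 ?(ltW e0)//.
exact: ltW.
Qed.

(** The odd extension of the p-th power; the cyclic triangle inequality in [poincare_powR] relies on
    its oddness. *)
Definition signed_powR p a : R := Num.sg a * `|a| `^ p.

Lemma signed_powRN p a : signed_powR p (- a) = - signed_powR p a.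
Proof. by rewrite /signed_powR sgrN normrN mulNr. Qed.

Lemma ge0_signed_powR p a : 0 < p -> 0 <= a -> signed_powR p a = a `^ p.
Proof.
move=> p0; rewrite /signed_powR le_eqVlt => /predU1P[<-|a0].
  by rewrite sgr0 mul0r powR0// gt_eqF.
by rewrite gtr0_sg// mul1r gtr0_norm.
Qed.

Lemma norm_signed_powR p a : 0 < p -> `|signed_powR p a| = `|a| `^ p.
Proof.
move=> p0; have [a0|/ltW a0] := leP 0 a.
  by rewrite ge0_signed_powR// !ger0_norm ?powR_ge0.
rewrite -normrN -signed_powRN ge0_signed_powR ?oppr_ge0//.
by rewrite ger0_norm ?powR_ge0// ler0_norm.
Qed.

Lemma signed_powR_dist_le a b eps p q : 0 < eps -> 1 <= p -> p <= q%:R ->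
  `|signed_powR p a - signed_powR p b| <=
  q%:R * (eps * (`|a| `^ p + `|b| `^ p) + eps `^ (1 - p) * `|a - b| `^ p).
Proof.
move=> e0 p1 pq; have p0 : 0 < p by exact: lt_le_trans p1.
have q1 : 1 <= q%:R :> R by exact: le_trans pq.
wlog ba : a b / `|b| <= `|a|.
  move=> wl; have [|/ltW] := leP `|b| `|a|; first exact: wl.
  by move/wl; rewrite distrC [`|b| `^ p + _]addrC [`|b - a|]distrC.
wlog a0 : a b ba / 0 <= a.
  move=> wl; have [|a0] := leP 0 a; first exact: wl.
  have := wl (- a) (- b); rewrite !normrN !signed_powRN -!opprD !normrN.
  by apply; rewrite // oppr_ge0 ltW.
apply: (@le_trans _ _ (q%:R * (`|a - b| * a `^ (p - 1)))); last first.
  rewrite ler_wpM2l// (le_trans (mul_powRB1_le _ a0 e0 p1))// lerD2r.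
  by rewrite ler_wpM2l ?(ltW e0)// (ger0_norm a0) lerDl powR_ge0.
rewrite (ger0_norm a0) in ba; rewrite ge0_signed_powR//.
have [b0|/ltW b0] := leP 0 b.
  rewrite (ger0_norm b0) in ba; rewrite ge0_signed_powR// !ger0_norm ?subr_ge0//.
    by apply: powRB_le; rewrite ?b0.
  by rewrite ge0_ler_powR// ?nnegrE// ltW.
(* Opposite signs: [a - b] is the sum of the absolute values, and each p-th power is at most its
   base times a ^ (p - 1). *)
rewrite (ler0_norm b0) in ba.
rewrite -[signed_powR p b]opprK -signed_powRN opprK ge0_signed_powR ?oppr_ge0//.
rewrite !ger0_norm ?addr_ge0 ?powR_ge0 ?oppr_ge0//.
rewrite -[leLHS]mul1r ler_pM ?addr_ge0 ?powR_ge0 ?oppr_ge0//.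
rewrite mulrDl (mulr_powRB1 a0 p0) lerD2l -(mulr_powRB1 _ p0) ?oppr_ge0//.
by rewrite ler_wpM2l ?oppr_ge0// ge0_ler_powR ?subr_ge0 ?nnegrE ?oppr_ge0.
Qed.

End signed_power.

(** * Poincare inequalities for absolute values and for p-th powers *)

(** For indicators absolute values equal squares, so [poincare_sqr] controls cuts, and
    [le_sum_dist_cuts] extends this to all [f]. *)
Lemma poincare_l1 (R : realFieldType) k n m (G : 'M['F_2]_(k, n)) (f : 'rV_k -> R) :
  (forall u, u != 0 -> (m <= weight (u *m G))%N) ->
  2 * m%:R * \sum_x \sum_y `|f x - f y| <=
  (2 ^ k)%:R * \sum_j \sum_x `|f x - f (x + (col j G)^T)|.
Proof.
move=> mG.
have sqrE (A : {set 'rV['F_2]_k}) x y : `|(x \in A)%:R - (y \in A)%:R| =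
    ((x \in A)%:R - (y \in A)%:R) ^+ 2 :> R.
  by case: (x \in A); case: (y \in A) => /=;
    rewrite ?subrr ?subr0 ?sub0r ?normrN ?normr0 ?normr1 ?sqrrN ?expr0n ?expr1n.
rewrite pair_bigA [in leRHS]pair_bigA/=.
apply: (le_sum_dist_cuts (fun A => _)) => A.
under eq_bigr do rewrite sqrE.
under [in leRHS]eq_bigr do rewrite sqrE.
have := poincare_sqr (fun x => (x \in A)%:R : R) mG.
by rewrite pair_bigA [in leRHS]pair_bigA.
Qed.

(* Matousek's extrapolation: apply the l_1 inequality to the signed powers of
   f - f w and sum over w. *)
Lemma poincare_powR (R : realType) (T J : finType) (s : J -> T -> T)
    (A B p : R) q :
  (forall j, injective (s j)) -> 0 < A -> 0 <= B ->
  B * #|J|%:R <= A * #|T|%:R ->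
  (forall f : T -> R,
    \sum_x \sum_y `|f x - f y| <= B * \sum_j \sum_x `|f x - f (s j x)|) ->
  1 <= p -> p <= q%:R ->
  forall f : T -> R, \sum_x \sum_y `|f x - f y| `^ p <=
    3 * q%:R * (6 * q%:R * A) `^ (p - 1) * B *
      \sum_j \sum_x `|f x - f (s j x)| `^ p.
Proof.
move=> s_inj A0 B0 BJ l1 p1 pq f; have p0 : 0 < p by exact: lt_le_trans p1.
have q0 : 0 < q%:R :> R by exact: lt_le_trans pq.
pose N : R := #|T|%:R.
have [x0 _|T0] := pickP (predT : pred T); last first.
  rewrite big1 => [|x]; last by have := T0 x.
  apply: mulr_ge0; first by rewrite !mulr_ge0 ?powR_ge0 ?(ltW q0).
  by apply: sumr_ge0 => j _; apply: sumr_ge0 => x _; rewrite powR_ge0.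
have N0 : 0 < N by rewrite ltr0n; apply/card_gt0P; exists x0.
pose S := \sum_x \sum_y `|f x - f y| `^ p; rewrite -/S.
pose E := \sum_j \sum_x `|f x - f (s j x)| `^ p; rewrite -/E.
pose h w x := signed_powR p (f x - f w).
(* With [B * #|J| <= A * #|T|], this choice makes the error term at most [N * S], half of the lower
   bound [2 * N * S]. *)
pose eps := (6 * q%:R * A)^-1.
have C0 : 0 < 6 * q%:R * A by rewrite !mulr_gt0.
have e0 : 0 < eps by rewrite invr_gt0.
have S0 : 0 <= S by apply: sumr_ge0 => x _; apply: sumr_ge0 => y _; rewrite powR_ge0.
(* With phi odd, the cyclic permutations of each triple (x, y, w) contribute
   together at least 2 |phi (f x - f y)|, by the triangle inequality. *)
have lower : 2 * N * S <= 3 * \sum_w \sum_x \sum_y `|h w x - h w y|.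
  pose t x y w := `|h w x - h w y|.
  have -> : 3 * \sum_w \sum_x \sum_y `|h w x - h w y| =
      \sum_w \sum_x \sum_y (t x y w + t y w x + t w x y).
    under [RHS]eq_bigr do under eq_bigr do rewrite !big_split/=.
    under [RHS]eq_bigr do rewrite !big_split/=.
    rewrite !big_split/=.
    have -> : \sum_w \sum_x \sum_y t y w x = \sum_w \sum_x \sum_y t x y w.
      by rewrite exchange_big; apply: eq_bigr => z _; rewrite exchange_big.
    have -> : \sum_w \sum_x \sum_y t w x y = \sum_w \sum_x \sum_y t x y w.
      by rewrite [RHS]exchange_big; apply: eq_bigr => z _; rewrite exchange_big.
    by ring.
  have -> : 2 * N * S = \sum_(w : T) \sum_x \sum_y 2 * `|f x - f y| `^ p.
    rewrite sumr_const -[RHS]mulr_natl -/N [2 * N]mulrC -mulrA.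
    congr (_ * _); rewrite mulr_sumr; apply: eq_bigr => x _.
    by rewrite mulr_sumr.
  apply: ler_sum => w _; apply: ler_sum => x _; apply: ler_sum => y _.
  rewrite -norm_signed_powR// /t /h.
  set a := signed_powR p (f x - f y); set b := signed_powR p (f y - f w).
  set c := signed_powR p (f w - f x).
  rewrite -[f x - f w]opprB -[f w - f y]opprB -[f y - f x]opprB !signed_powRN.
  rewrite -/a -/b -/c -[2]gtr0_norm// -normrM.
  have -> : 2 * a = (- c - b) - (- a - c) - (- b - a) by ring.
  by rewrite (le_trans (ler_normB _ _))// lerD2r ler_normB.
have upper : \sum_w \sum_x \sum_y `|h w x - h w y| <=
    B * q%:R * (2 * eps * #|J|%:R * S + N * eps `^ (1 - p) * E).
  have SE : \sum_w \sum_x `|f x - f w| `^ p = S by rewrite exchange_big.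
  (* Each [s j] is a permutation of [T], so the second endpoints of the edges contribute as much as
     the first. *)
  have shiftE : \sum_w \sum_j \sum_x `|f (s j x) - f w| `^ p = #|J|%:R * S.
    rewrite mulr_natl -sumr_const -SE exchange_big; apply: eq_bigr => j _.
    by apply: eq_bigr => w _; rewrite [RHS](reindex_inj (s_inj j)).
  have sumE : \sum_(w : T) \sum_(j : J) \sum_x `|f x - f w| `^ p = #|J|%:R * S.
    rewrite mulr_natl -sumr_const -SE exchange_big; apply: eq_bigr => j _.
    by apply: eq_bigr.
  apply: (@le_trans _ _ (\sum_w B * \sum_j \sum_x
      q%:R * (eps * (`|f x - f w| `^ p + `|f (s j x) - f w| `^ p) +
              eps `^ (1 - p) * `|f x - f (s j x)| `^ p))).
    apply: ler_sum => w _; apply: (le_trans (l1 (h w))); rewrite ler_wpM2l//.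
    apply: ler_sum => j _; apply: ler_sum => x _.
    rewrite (le_trans (signed_powR_dist_le _ _ e0 p1 pq))//.
    by rewrite (_ : f x - f w - (f (s j x) - f w) = f x - f (s j x))//; ring.
  rewrite -mulr_sumr -mulrA ler_wpM2l//.
  under eq_bigr do under eq_bigr do
    rewrite -mulr_sumr big_split/= -!mulr_sumr big_split/=.
  under eq_bigr do rewrite -mulr_sumr big_split/= -!mulr_sumr big_split/=.
  rewrite -mulr_sumr big_split/= -!mulr_sumr big_split/= sumE shiftE.
  rewrite sumr_const -/E -[E *+ _]mulr_natl -/N ler_wpM2l ?(ltW q0)//.
  by rewrite le_eqVlt; apply/orP; left; apply/eqP; ring.
have epsE : eps `^ (1 - p) = (6 * q%:R * A) `^ (p - 1).
  by rewrite /eps -powR_inv1 ?ltW// -powRrM mulN1r opprB.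
rewrite -epsE -(ler_pM2l N0).
have := le_trans lower (ler_wpM2l _ upper); move=> /(_ (ler0n _ 3)) fin.
have absorb : 3 * (B * q%:R * (2 * eps * #|J|%:R * S)) <= N * S.
  have -> : 3 * (B * q%:R * (2 * eps * #|J|%:R * S)) =
    (B * #|J|%:R) * (6 * q%:R * eps * S) by ring.
  have -> : N * S = (A * N) * (6 * q%:R * eps * S).
    rewrite /eps; field.
    by rewrite !gt_eqF.
  by rewrite ler_wpM2r// !mulr_ge0// ltW.
have -> : N * (3 * q%:R * eps `^ (1 - p) * B * E) =
  3 * (B * q%:R * (N * eps `^ (1 - p) * E)) by ring.
rewrite mulrDr mulrDr in fin.
lra.
Qed.

(** * Passage from real-valued to L_p-valued maps *)

Section Lspace_inequality.
Context d (U : measurableType d) (R : realType) (mu : {measure set U -> \bar R}).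
Variables (p : R) (p1 : (1 <= p%:E)%E).
Local Notation Lp := (LspaceType mu p1).

Lemma measurable_Lspace (f : Lp) : measurable_fun setT (f : U -> R).
Proof. exact: (@measurable_funPT _ _ _ _ (repr (LebesgueSpace.sort f))). Qed.

Lemma Lspace_mdist_powR (f g : Lp) :
  ((mdist f g `^ p)%:E = \int[mu]_x (`|f x - g x| `^ p)%:E)%E.
Proof.
have p_neq0 : p != 0 by rewrite gt_eqF// (lt_le_trans ltr01).
have := poweR_Lnorm mu (EFin \o (f \- g)%R) p_neq0 => /= <-.
(* Minkowski's inequality makes the norm of the difference finite, so [fine] loses nothing. *)
rewrite Lspace_mdistE -poweR_EFin fineK// ge0_fin_numE ?Lnorm_ge0//.
have -> : (f \- g)%R = ((f : U -> R) \+ (\- (g : U -> R)))%R by [].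
have mg : measurable_fun setT (\- (g : U -> R))%R.
  exact/measurableT_comp/measurable_Lspace.
apply: (le_lt_trans (eminkowski mu (measurable_Lspace f) mg p1)).
rewrite (_ : EFin \o (\- _)%R = \- (EFin \o g))%E// oppe_Lnorm.
by rewrite lte_add_pinfty//; exact: Lebesgue_finite.
Qed.

(** By [Lspace_mdist_powR] the p-th powers of distances are integrals, so the scalar inequality is
    applied to [F^~ x] at each point [x] and integrated. *)
Lemma le_sum_Lspace_dist (T I J : finType) (a b : I -> T) (c e : J -> T) (K : R) :
  0 <= K ->
  (forall f : T -> R, \sum_i `|f (a i) - f (b i)| `^ p <=
    K * \sum_j `|f (c j) - f (e j)| `^ p) ->
  forall F : T -> Lp, \sum_i mdist (F (a i)) (F (b i)) `^ p <=
    K * \sum_j mdist (F (c j)) (F (e j)) `^ p.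
Proof.
move=> K0 ineq F; rewrite -lee_fin EFinM -!sumEFin.
under eq_bigr do rewrite Lspace_mdist_powR.
under [in leRHS]eq_bigr do rewrite Lspace_mdist_powR.
have mF (x y : T) :
    measurable_fun setT (EFin \o (fun u => `|F x u - F y u| `^ p)).
  apply/measurable_EFinP.
  apply: (@measurableT_comp _ _ _ _ _ _ (@powR R ^~ p)) => //.
  apply: measurableT_comp => //.
  by apply: measurable_funB; exact: measurable_Lspace.
rewrite -!ge0_integral_sum//; [|by move=> n; exact: mF..].
rewrite -ge0_integralZl//; last 2 first.
  by apply: emeasurable_sum => j; exact: mF.
  by move=> x _; rewrite sume_ge0// => j _; rewrite lee_fin powR_ge0.
apply: ge0_le_integral => //.
- by move=> x _; rewrite sume_ge0// => j _; rewrite lee_fin powR_ge0.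
- by apply: emeasurable_sum => i; exact: mF.
- by apply: measurable_funeM; apply: emeasurable_sum => j; exact: mF.
- by move=> x _; rewrite !sumEFin -EFinM lee_fin; exact: (ineq (F^~ x)).
Qed.

End Lspace_inequality.

(** * Bounds for the transportation cost, and the coset measures *)

Section transport_bounds.
Variables (R : realType) (n : nat).
Local Notation T := (hypercube n).
Implicit Types P Q : probability T R.

Lemma measurable_hypercube2 (A : set (T * T)) : measurable A.
Proof.
rewrite (_ : A = \bigcup_(z in A) ([set z.1] `*` [set z.2])).
  apply: fin_bigcup_measurable => [|z _]; first exact: finite_finset.
  exact: measurableX.
by apply/seteqP; split => [[x y] ?|[_ _] [[x y] ? [/= -> ->]]//]; exists (x, y).
Qed.

Lemma measurable_fun_hypercube2 (f : T * T -> \bar R) : measurable_fun setT f.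
Proof. by move=> _ Y _; exact: measurable_hypercube2. Qed.

(** The image of [q] under the pair [(a, b)] is a coupling, and the right-hand side is its cost. *)
Lemma transport_dist_mfinite_le (I : finType) (i0 : I) (q : I -> {nonneg R})
    (a b : I -> T) P Q :
  (forall A, P A = mfinite i0 q a A) -> (forall A, Q A = mfinite i0 q b A) ->
  transport_dist P Q <= \sum_i (q i)%:num * (hamming (a i) (b i))%:R.
Proof.
move=> PE QE.
pose m := mfinite i0 q (fun i => (a i, b i)).
have mE A : m A = (\sum_i (q i)%:num%:E * (\1_A (a i, b i))%:E)%E.
  by rewrite mfiniteE//; exact: measurable_hypercube2.
have m1 : m setT = 1%E.
  transitivity (P setT); last exact: probability_setT.
  by rewrite mE PE mfiniteE.
have [pi piE] := exists_probability m1.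
rewrite -lee_fin -transport_distE; apply: ereal_inf_lbound; exists pi.
  split => A _; rewrite /pushforward/= piE mE.
    by rewrite PE mfiniteE.
  by rewrite QE mfiniteE.
rewrite (eq_measure_integral m); last by move=> A _ _; exact: piE.
rewrite integral_mfinite -?sumEFin//; first exact: measurable_fun_hypercube2.
Qed.

(** By a union bound on the complements, every coupling is carried by the product of [A] and [B],
    where the integrand is at least [r]. *)
Lemma le_transport_dist r (A B : set T) P Q :
  P A = 1%E -> Q B = 1%E ->
  (forall x y, A x -> B y -> (r <= hamming x y)%N) ->
  r%:R <= transport_dist P Q.
Proof.
move=> PA QB rAB; rewrite -lee_fin -transport_distE.
apply: le_ereal_inf_tmp => _ [pi [piP piQ] <-].
have mAB (E : set (T * T)) : measurable E := measurable_hypercube2 E.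
have piAB : pi (A `*` B) = 1%E.
  apply/eqP; rewrite eq_le probability_le1//=.
  have : (pi (~` (A `*` B)) <= pi (fst @^-1` (~` A)) + pi (snd @^-1` (~` B)))%E.
    rewrite (le_trans _ (measureU2 _ _ _))// le_measure ?inE//.
    by move=> [x y] /= /not_andP.
  rewrite [X in (_ <= X + _)%E](_ : _ = pushforward pi fst (~` A))//.
  rewrite [X in (_ <= _ + X)%E](_ : _ = pushforward pi snd (~` B))//.
  rewrite piP// piQ// !probability_setC// PA QB subee// adde0.
  by rewrite lee_subel_addr// add0e.
rewrite -[leLHS](_ : \int[pi]_(z in A `*` B) r%:R%:E = _)%E; last first.
  by rewrite integral_cst// [X in (_ * X)%E]piAB mule1.
apply: (@le_trans _ _ (\int[pi]_(z in A `*` B) (hamming z.1 z.2)%:R%:E)%E).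
  apply: ge0_le_integral => //.
  by move=> z [Az Bz]; rewrite lee_fin ler_nat rAB.
exact: ge0_subset_integral.
Qed.

End transport_bounds.

(* mu s is the uniform measure on the coset {x | x *m G^T = s}; the columns of
   G are the syndromes of the basis vectors. *)
Lemma exists_coset_laws (R : realType) n k (G : 'M['F_2]_(k, n)) : row_free G ->
  exists mu : 'rV['F_2]_k -> cube_probability R n,
    (forall s j, mdist (mu s) (mu (s + (col j G)^T)) <= 1) /\
    (forall s t r, (forall x, x *m G^T = s - t -> (r <= weight x)%N) ->
      r%:R <= mdist (mu s) (mu t)).
Proof.
case/row_freeP => B GB.
pose C := [set c : 'rV['F_2]_n | c *m G^T == 0]%SET.
have C0 : (0 < #|C|)%N by apply/card_gt0P; exists 0; rewrite inE mul0mx.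
have q0 c : 0 <= (c \in C)%:R / #|C|%:R :> R by rewrite divr_ge0.
pose q c := NngNum (q0 c).
have sumq : (\sum_c (q c)%:num = 1 :> R).
  rewrite /= -mulr_suml -natr_sum -big_mkcond/= sum1_card divff//.
  by rewrite pnatr_eq0 -lt0n.
(* The law of [x + c] for [c] uniform on the dual code [C]; it depends only on the coset of [x]. *)
pose law (x : hypercube n) := mfinite (0 : hypercube n) q
  (fun c => (x : 'rV['F_2]_n) + c : hypercube n).
(* The transpose of the right inverse [B] of [G] selects a representative of each coset. *)
pose lift (s : 'rV['F_2]_k) : 'rV['F_2]_n := s *m B^T.
have liftK s : lift s *m G^T = s by rewrite -mulmxA -trmx_mul GB trmx1 mulmx1.
have lawE x A : law x A =
    (\sum_c (q c)%:num%:E * (\1_A ((x : 'rV['F_2]_n) + c : hypercube n))%:E)%E.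
  by rewrite mfiniteE.
have law_coset x y : x *m G^T = y *m G^T -> law x = law y :> (set _ -> \bar R).
  move=> xy; apply/funext => A; rewrite !lawE.
  rewrite [RHS](reindex_inj (addrI (x - y)))/=; apply: eq_bigr => c _.
  have -> : y + (x - y + c) = x + c by rewrite addrA addrCA subrr addr0.
  by rewrite !inE mulmxDl mulmxBl xy subrr add0r.
have law1 x : law x setT = 1%E.
  rewrite lawE -sumq -sumEFin; apply: eq_bigr => c _.
  by rewrite indicT mule1.
have /choice[mu muE] s : exists P : cube_probability R n,
    forall A, (P : probability _ R) A = law (lift s) A.
  exact: exists_probability (law1 _).
exists mu; split => [s j|s t r st].
  have eE : (delta_mx 0 j : 'rV['F_2]_n) *m G^T = (col j G)^T.
    by rewrite -rowE tr_col.
  rewrite cube_mdistE.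
  (* The coupling moves every [lift s + c] along the single coordinate [j]. *)
  apply: (le_trans (@transport_dist_mfinite_le _ _ _ (0 : hypercube n) q
    (fun c => lift s + c) (fun c => lift s + delta_mx 0 j + c) _ _ _ _)).
  - exact: muE.
  - move=> A; rewrite muE; congr (_ A); apply: law_coset.
    by rewrite mulmxDl !liftK eE.
  rewrite -[leRHS]sumq; apply: ler_sum => c _.
  rewrite -[leRHS]mulr1 ler_wpM2l// hammingE.
  have -> : lift s + c - (lift s + delta_mx 0 j + c) = - delta_mx 0 j.
    by move: (lift s) => a; apply/rowP => i; rewrite !mxE; ring.
  rewrite lern1; apply: (@leq_trans #|[set j]%SET|); last by rewrite cards1.
  apply: subset_leq_card.
  apply/fintype.subsetP => i; rewrite !inE !mxE eqxx/=.
  by case: (i == j).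
have muF u : (mu u : probability _ R) [set x | (x : 'rV['F_2]_n) *m G^T = u] = 1%E.
  rewrite muE lawE -sumq -sumEFin; apply: eq_bigr => c _.
  rewrite indicE; have [cC|cC] := boolP (c \in C); last first.
    by rewrite /= (negbTE cC) mul0r mul0e.
  rewrite mem_set ?mule1//= mulmxDl liftK.
  by move: cC; rewrite inE => /eqP ->; rewrite addr0.
rewrite cube_mdistE; apply: (le_transport_dist (muF s) (muF t)) => x y /= xs yt.
by rewrite hammingE; apply: st; rewrite mulmxBl xs yt.
Qed.

(** * Lower bound for the distortion *)

(** Two distinct points and injectivity make both Lipschitz norms positive, so an infinite norm
    forces the product to be [+oo]; only finite norms [K] and [L] remain to be treated. *)
Lemma le_distortion (R : realType) (X Y : metricType R) (f : X -> Y) (c : R) :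
  (exists x y : X, x != y) ->
  (forall K L, 0 < K -> 0 < L ->
    (forall x y, mdist (f x) (f y) <= K * mdist x y) ->
    (forall x y, mdist x y <= L * mdist (f x) (f y)) -> c <= K * L) ->
  (c%:E <= distortion f)%E.
Proof.
move=> [x0 [y0 xy0]] cKL; rewrite /distortion.
case: asboolP => [f_inj|_]; last by rewrite leey.
have f_neq x y : x != y -> f x != f y by apply: contra_neq => /f_inj.
have le_lip x y : x != y ->
    ((mdist (f x) (f y) / mdist x y)%:E <= lip_norm f)%E.
  by move=> xy; rewrite le_max ereal_sup_ubound ?orbT//; exists (x, y).
have le_lip_inv x y : x != y ->
    ((mdist x y / mdist (f x) (f y))%:E <= lip_norm_inv f)%E.
  move=> xy; rewrite le_max ereal_sup_ubound ?orbT//.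
  by exists (x, y) => //=; exact: f_neq.
have lip0 : (0 < lip_norm f)%E.
  by rewrite (lt_le_trans _ (le_lip _ _ xy0))// lte_fin divr_gt0// mdist_gt0// f_neq.
have lip_inv0 : (0 < lip_norm_inv f)%E.
  by rewrite (lt_le_trans _ (le_lip_inv _ _ xy0))// lte_fin divr_gt0// mdist_gt0// f_neq.
move: (lip_norm f) (lip_norm_inv f) lip0 lip_inv0 le_lip le_lip_inv.
move=> [K| |] [L| |] //; rewrite ?lte_fin => K0 L0 leK leL.
- rewrite -EFinM lee_fin; apply: cKL => // x y; have [->|xy] := eqVneq x y.
  + by rewrite !mdistxx mulr0.
  + by rewrite -ler_pdivrMr ?mdist_gt0// -lee_fin leK.
  + by rewrite !mdistxx mulr0.
  + by rewrite -ler_pdivrMr ?mdist_gt0 ?f_neq// -lee_fin leL.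
- by rewrite gt0_muley// leey.
- by rewrite gt0_mulye// leey.
- by rewrite gt0_mulye// leey.
Qed.

Lemma Lp_distortion_cube_probability (R : realType) (p : R)
    (p1 : (1 <= p%:E)%E) :
  exists2 c : R, 0 < c & forall n, (1 <= n)%N ->
    ((c * n%:R)%:E <= Lp_distortion p1 (cube_probability R n))%E.
Proof.
have p1' : 1 <= p by rewrite -lee_fin.
have p0 : 0 < p by exact: lt_le_trans p1'.
pose q := Num.bound p.
have pq : p <= q%:R by rewrite ltW// archi_boundP// ltW.
have q1 : 1 <= q%:R :> R by exact: le_trans pq.
have q0 : 0 < q%:R :> R by exact: lt_le_trans q1.
(* The constant of [poincare_powR] for [A = 8], without its factor [B], times 16: a factor 2 for
   keeping only the far half of the pairs and a factor 8 from [Bn]. *)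
pose K := 16 * (3 * q%:R * (6 * q%:R * 8) `^ (p - 1)).
(* This gives K <= K ^ p, which is used to take p-th roots in [KL]. *)
have K1 : 1 <= K.
  rewrite /K mulrA -[leLHS]mulr1 ler_pM//; first lra.
  have a1 : 1 <= 6 * q%:R * 8 :> R by lra.
  have pm1 : 0 <= p - 1 by rewrite subr_ge0.
  by have := ler_powR a1 pm1; rewrite powRr0.
have K0 : 0 < K by exact: lt_le_trans K1.
exists (16 * K)^-1; first by rewrite invr_gt0 mulr_gt0.
move=> n n0; apply: le_ereal_inf_tmp => _ [f _ <-].
have [k [G [ballG weightG]]] := exists_large_code n0.
set r := (n %/ 16)%N in ballG weightG.
have nr : (n%:R <= 16 * r.+1%:R :> R).
  by rewrite -natrM ler_nat mulnC ltnW// -ltn_divLR.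
have Gfree : row_free G.
  by apply: inj_row_free => u uG0; apply: contraTeq (leq0n r) => /weightG;
    rewrite uG0 (eqP (_ : weight 0 == 0%N)) ?weight_eq0.
have [mu [mu_edge mu_far]] := exists_coset_laws R Gfree.
pose N : R := (2 ^ k)%:R.
have N0 : 0 < N by rewrite ltr0n expn_gt0.
pose far (s : 'rV['F_2]_k) : {set 'rV['F_2]_k} :=
  [set t | [forall x : 'rV['F_2]_n, (x *m G^T == s - t) ==> (r < weight x)%N]]%SET.
have farP s t : t \in far s -> r.+1%:R <= mdist (mu s) (mu t).
  rewrite inE => /forallP st; apply: mu_far => x /eqP xst.
  by have := st x; rewrite xst.
(* If [t] is not far from [s], then [t = s - x *m G^T] with [x] of weight at most [r], so there are
   at most [ball_card n r] such [t], at most half of all. *)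
have card_far s : N <= 2 * #|far s|%:R.
  have near_le : (#|~: far s| <= ball_card n r)%N.
    apply: (leq_trans _ (leq_imset_card (fun x => s - x *m G^T) _)).
    apply/subset_leq_card/fintype.subsetP => t; rewrite !inE negb_forall.
    move=> /existsP[x]; rewrite negb_imply -leqNgt => /andP[/eqP xst xr].
    by apply/imsetP; exists x; rewrite ?inE// xst opprB addrC subrK.
  have cardE := cardsC (far s); rewrite card_rVF2 in cardE.
  rewrite -natrM ler_nat -cardE mul2n -addnn leq_add2l.
  rewrite -(leq_add2r #|~: far s|) cardE addnn -mul2n.
  by rewrite (leq_trans _ ballG)// leq_mul2l.
apply: le_distortion.
  have /card_gt0P[t t0] : (0 < #|far 0%R|)%N.
    by have := card_far 0; case: #|_| => //; rewrite mulr0 leNgt N0.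
  exists (mu 0), (mu t); apply/eqP => e.
  by have := farP _ _ t0; rewrite e mdistxx lern0.
move=> L L' L0 L'0 fL fL'.
pose F s := f (mu s).
(* The constant of [poincare_l1] with [m = r.+1]; [Bn] is then the degree condition of
   [poincare_powR] with [A = 8]. *)
pose B : R := N / (2 * r.+1%:R).
have B0 : 0 < B by rewrite divr_gt0// mulr_gt0.
have Bn : B * n%:R <= 8 * N.
  rewrite /B mulrAC ler_pdivrMr ?mulr_gt0//.
  by rewrite (mulrC 8) -mulrA ler_wpM2l ?(ltW N0)// mulrA -natrM.
have l1 (g : 'rV['F_2]_k -> R) : \sum_x \sum_y `|g x - g y| <=
    B * \sum_j \sum_x `|g x - g (x + (col j G)^T)|.
  rewrite /B mulrAC ler_pdivlMr ?mulr_gt0// mulrC.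
  exact: (poincare_l1 g weightG).
have lp := poincare_powR (fun j => addIr (col j G)^T) (ltr0n R 8) (ltW B0) _ l1 p1' pq.
have {}lp := lp _; rewrite card_ord card_rVF2 in lp; have {}lp := lp Bn.
set C := 3 * q%:R * (6 * q%:R * 8) `^ (p - 1) * B in lp.
have C0 : 0 <= C by rewrite !mulr_ge0 ?powR_ge0// ltW.
have sumF : \sum_z mdist (F z.1) (F z.2) `^ p <=
    C * \sum_z mdist (F z.2) (F (z.2 + (col z.1 G)^T)) `^ p.
  apply: (le_sum_Lspace_dist C0) => g.
  by have := lp g; rewrite pair_bigA [in leRHS]pair_bigA.
(* Adjacent cosets have measures at distance at most 1, so their images are at distance at most
   [L]. *)
have upper : \sum_(z : 'I_n * 'rV['F_2]_k)
    mdist (F z.2) (F (z.2 + (col z.1 G)^T)) `^ p <= n%:R * N * L `^ p.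
  apply: (@le_trans _ _ (\sum_(z : 'I_n * 'rV['F_2]_k) L `^ p)).
    apply: ler_sum => z _; rewrite ge0_ler_powR ?nnegrE ?mdist_ge0 ?(ltW L0) ?(ltW p0)//.
    by rewrite (le_trans (fL _ _))// ler_piMr ?mu_edge// ltW.
  by rewrite sumr_const card_prod card_ord card_rVF2 -[leLHS]mulr_natl natrM.
(* Only the far pairs are kept, at least half of all; their images are at distance at least
   [r.+1 / L']. *)
have lower : N * (N * (r.+1%:R / L') `^ p) <=
    2 * \sum_(z : 'rV['F_2]_k * 'rV['F_2]_k) mdist (F z.1) (F z.2) `^ p.
  rewrite -(pair_bigA _ (fun s t => mdist (F s) (F t) `^ p))/= mulr_sumr.
  rewrite {1}/N -card_rVF2 mulr_natl -sumr_const; apply: ler_sum => s _.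
  rewrite (bigID (mem (far s)))/= mulrDr -[leLHS]addr0 lerD//; last first.
    by rewrite mulr_ge0// sumr_ge0// => t _; rewrite powR_ge0.
  apply: (@le_trans _ _ (2 * \sum_(t in far s) (r.+1%:R / L') `^ p)).
    by rewrite sumr_const -[X in 2 * X]mulr_natl mulrA ler_wpM2r ?powR_ge0.
  rewrite ler_wpM2l//; apply: ler_sum => t ts.
  rewrite ge0_ler_powR ?nnegrE ?mdist_ge0 ?divr_ge0 ?(ltW L'0) ?(ltW p0)//.
  by rewrite ler_pdivrMr// mulrC (le_trans (farP _ _ ts)).
have KL : (r.+1%:R / L') `^ p <= (K * L) `^ p.
  have : N * (N * (r.+1%:R / L') `^ p) <= N * (N * (K * L `^ p)).
    apply: (le_trans lower); apply: (@le_trans _ _ (2 * (C * (n%:R * N * L `^ p)))).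
      by rewrite ler_wpM2l// (le_trans sumF)// ler_wpM2l.
    have -> : 2 * (C * (n%:R * N * L `^ p)) = K / 8 * N * L `^ p * (B * n%:R).
      by rewrite /C /K; field.
    have -> : N * (N * (K * L `^ p)) = K / 8 * N * L `^ p * (8 * N) by field.
    by rewrite ler_wpM2l// !mulr_ge0 ?powR_ge0// ltW.
  rewrite !ler_pM2l// => /le_trans; apply.
  rewrite powRM ?(ltW K0) ?(ltW L0)// ler_wpM2r ?powR_ge0//.
  by rewrite -[leLHS]powRr1 ?(ltW K0)// ler_powR.
have {}KL : r.+1%:R / L' <= K * L.
  rewrite leNgt; apply/negP => /(gt0_ltr_powR p0).
  rewrite ltNge KL !nnegrE divr_ge0 ?mulr_ge0 ?(ltW K0) ?(ltW L0) ?(ltW L'0)//.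
  by move=> /(_ isT isT).
(* It remains to chain [n <= 16 * r.+1] with [r.+1 <= K * L * L']. *)
rewrite ler_pdivrMl; last exact: mulr_gt0.
rewrite (le_trans nr)// -mulrA ler_wpM2l//.
by rewrite mulrA -ler_pdivrMr.
Qed.

Theorem corollary3p7 (R : realType) :
  (exists2 c : R, 0 < c &
    forall d : nat, (1 <= d)%N ->
      ((c * d%:R)%:E <= Lp_distortion (lexx 1%E) (cube_probability R d))%E) /\
  (forall (p : R) (p1 : (1 <= p%:E)%E),
    exists2 c : R, 0 < c &
      forall d : nat, (1 <= d)%N ->
        ((c * d%:R)%:E <= Lp_distortion p1 (cube_probability R d))%E).
Proof.
split=> [|p p1]; last exact: Lp_distortion_cube_probability.
exact: Lp_distortion_cube_probability (lexx 1%E).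
Qed.
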